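(* Fix an integer $d\ge 2$ and a real number $\kappa>0$. For integers $m\ge n\ge 1$ let $p_{\rm e}(n,m,d)$ denote the probability, taken jointly over a Haar-random single-particle propagator $\mathbf V\in \mathrm U(dm)$ and the Born rule of the block-occupation monitoring, that the monitoring of the $n$-fermion output state yields a collision-free record with exactly $n$ singly occupied blocks. Then there exists a constant $c_{\kappa,d}>0$, independent of $n$, such that for every $n\ge 1$ for which $m=\kappa n^2$ is an integer with $m\ge n$, $$p_{\rm e}(n,\kappa n^2,d)\ \ge\ c_{\kappa,d}.$$
   Context: There are $dm$ fermionic modes with creation operators $a^\dagger_{j,\alpha}$, $j\in\{1,\dots,m\}$ (block), $\alpha\in\{0,\dots,d-1\}$ (internal label), acting on the fermionic Fock space over $\mathbb C^{dm}$ with vacuum $|{\rm vac}\rangle$. The input state has one fermion in each of the last $n$ blocks $m-n+1,\dots,m$, with the internal label of block $m-n+k$ maximally entangled with an auxiliary $d$-level system $A_k$: $$|\Psi_{\rm in}\rangle=d^{-n/2}\sum_{\alpha_1,\dots,\alpha_n=0}^{d-1} a^\dagger_{m-n+1,\alpha_1}\cdots a^\dagger_{m,\alpha_n}|{\rm vac}\rangle\otimes|\alpha_1,\dots,\alpha_n\rangle_{A_1\cdots A_n}.$$ A matrix $\mathbf V\in\mathrm U(dm)$, viewed as an $m\times m$ block matrix with blocks $V_{j,k}\in \mathrm M_d(\mathbb C)$, defines the second-quantized unitary $U(\mathbf V)$ with $U(\mathbf V)|{\rm vac}\rangle=|{\rm vac}\rangle$ and $U(\mathbf V)a^\dagger_{k,\alpha}U(\mathbf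 V)^\dagger=\sum_{j,\nu}(V_{j,k})_{\nu,\alpha}a^\dagger_{j,\nu}$; it acts on the fermionic factor of $|\Psi_{\rm in}\rangle$. The monitoring measures, for each block $j$, only whether the block is in the single-occupation sector (exactly one of its $d$ modes occupied), recorded as $c_j=1$, or not, recorded as $c_j=0$. The record is collision-free with exactly $n$ effective blocks if $c_j=1$ for exactly $n$ values of $j$ (all other blocks are then empty, since the total fermion number is $n$). Thus $p_{\rm e}(n,m,d)=\mathbb E_{\mathbf V}\,\|\Pi\,U(\mathbf V)|\Psi_{\rm in}\rangle\|^2$, where $\Pi$ is the projector onto the span of Fock basis states of $n$ fermions occupying $n$ distinct blocks and the expectation is over the Haar measure on $\mathrm U(dm)$. *)

(* Defs.v *)
From HB Require Import structures.
From mathcomp Require Import all_boot all_order all_algebra.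
From mathcomp Require Import spectral complex mxtens.

Set Implicit Arguments.
Unset Strict Implicit.
Unset Printing Implicit Defensive.

Import Order.TTheory GRing.Theory Num.Theory.

Local Open Scope ring_scope.
Local Open Scope sesquilinear_scope.

Section AnticommutingProduct.
Context {T : pzRingType} {N : nat} (b : 'I_N -> T).
Hypothesis b_anti : forall x y, b x * b y = - (b y * b x).
Hypothesis b_sqr0 : forall x, b x * b x = 0.

Let b_prod x (l : seq 'I_N) (P : pred 'I_N) :
  b x * (\prod_(y <- l | P y) b y) =
  (-1) ^+ count P l * ((\prod_(y <- l | P y) b y) * b x).
Proof.
elim: l => [|y l IH]; first by rewrite !big_nil expr0 !mul1r mulr1.
rewrite !big_cons /=; case: ifP => Py; last by rewrite add0n IH.
rewrite mulrA b_anti mulNr -mulrA IH exprD expr1 mulN1r mulNr.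
by congr (- _); rewrite !mulrA (commr_sign (b y)).
Qed.

Lemma anticommuting_prod x (S : {set 'I_N}) :
  b x * (\prod_(y in S) b y) =
  if x \notin S
  then (-1) ^+ #|[set y in S | (y < x)%N]| * \prod_(y in x |: S) b y else 0.
Proof.
have -> : #|[set y in S | (y < x)%N]| =
    count (fun y => (y \in S) && (y < x)%N) (index_enum 'I_N).
  by rewrite -sum1_card -sum1_count; apply: eq_bigl => y; rewrite inE.
have xI : x \in index_enum 'I_N by rewrite mem_index_enum.
have sI : sorted (fun i j : 'I_N => (i < j)%N) (index_enum 'I_N).
  have := iota_ltn_sorted 0 N; rewrite -val_enum_ord sorted_map.
  by rewrite enumT.
move: xI sI; move: (index_enum 'I_N) => r xr.
case/splitPr: xr => l1 l2.
rewrite sorted_pairwise => [|? ? ?]; last exact: ltn_trans.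
rewrite pairwise_cat /= allrel_consr => /and4P[/andP[l1x _] _ xl2 _].
rewrite !big_cat !big_cons /= !inE eqxx /= mulrA b_prod.
have -> : count (fun y => (y \in S) && (y < x)%N) (l1 ++ x :: l2) =
          count [in S] l1.
  rewrite count_cat /= ltnn andbF add0n -[RHS]addn0; congr (_ + _)%N.
    apply: eq_in_count => y yl1 /=; have /= -> := allP l1x _ yl1.
    by rewrite andbT.
  apply/eqP; rewrite -leqn0 leqNgt -has_count; apply/hasPn => y yl2.
  have /= /ltnW := allP xl2 _ yl2.
  by rewrite leqNgt => /negPf ->; rewrite andbF.
have E1 : \prod_(y <- l1 | y \in x |: S) b y = \prod_(y <- l1 | y \in S) b y.
  rewrite big_seq_cond [RHS]big_seq_cond; apply: eq_bigl => y.
  rewrite in_setU1; have [/= yl1|//] := boolP (y \in l1).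
  have /= := allP l1x _ yl1.
  by case: eqVneq => // ->; rewrite ltnn.
have E2 : \prod_(y <- l2 | y \in x |: S) b y = \prod_(y <- l2 | y \in S) b y.
  rewrite big_seq_cond [RHS]big_seq_cond; apply: eq_bigl => y.
  rewrite in_setU1; have [/= yl2|//] := boolP (y \in l2).
  have /= := allP xl2 _ yl2.
  by case: eqVneq => // ->; rewrite ltnn.
rewrite {}E1 {}E2.
have [xS|xS] /= := boolP (x \in S); last by rewrite -!mulrA.
by rewrite -!mulrA (mulrA (b x) (b x)) b_sqr0 mul0r !mulr0.
Qed.
End AnticommutingProduct.

Section Fock.
Context {C : numClosedFieldType} {N : nat}.

(* Operators on, and column vectors of, the 2^N-dimensional Fock space over
   C^N.  Its orthonormal basis consists of the Fock states [fket S], one for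
   each set S of occupied modes. *)
Definition fock_op := 'M[C]_#|{set 'I_N}|.
Definition fock_vec := 'cV[C]_#|{set 'I_N}|.

Definition fconf (i : 'I_#|{set 'I_N}|) : {set 'I_N} := enum_val i.

Definition fket (S : {set 'I_N}) : fock_vec := delta_mx (enum_rank S) 0.

Definition vac : fock_vec := fket set0.

(* Sign convention: for x1 < ... < xk, the Fock state [fket [set x1; ...; xk]]
   is a^dagger_x1 ... a^dagger_xk |vac>. *)
Definition fsign (x : 'I_N) (S : {set 'I_N}) : C :=
  (-1) ^+ #|[set y in S | (y < x)%N]|.

Definition creation (x : 'I_N) : fock_op :=
  \matrix_(i, j)
    if (x \notin fconf j) && (fconf i == x |: fconf j)
    then fsign x (fconf j) else 0.

Local Notation annih x := ((creation x)^t*).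

Let adjM p q r (A : 'M[C]_(p, q)) (B : 'M[C]_(q, r)) :
  (A *m B)^t* = B^t* *m A^t*.
Proof. by rewrite trmx_mul map_mxM. Qed.

Lemma fketP (p : nat) (A B : 'M[C]_(p, #|{set 'I_N}|)) :
  (forall S, A *m fket S = B *m fket S) -> A = B.
Proof.
move=> AB; apply/matrixP => i j.
have := congr1 (fun v : 'cV[C]_p => v i 0) (AB (fconf j)).
by rewrite /fket /fconf enum_valK -!colE !mxE.
Qed.

Lemma creation_fket x S : creation x *m fket S =
  (if x \notin S then fsign x S else 0) *: fket (x |: S).
Proof.
apply/colP => i; rewrite /fket -colE !mxE /fconf enum_rankK eqxx andbT.
rewrite -(inj_eq enum_val_inj i) enum_rankK.
by case: (x \notin S); case: eqP; rewrite ?mul0r ?mulr0 ?mulr1.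
Qed.

Lemma fsignU1 x y (S : {set 'I_N}) : y \notin S ->
  fsign x (y |: S) = (-1) ^+ (y < x)%N * fsign x S.
Proof.
move=> yS; rewrite /fsign -exprD; congr (_ ^+ _).
have [yx|xy] := ltnP y x.
  rewrite (_ : [set _ in _ | _] = y |: [set z in S | (z < x)%N]).
    by rewrite cardsU1 inE (negPf yS).
  apply/setP => z; rewrite !inE; case: eqP => //= ->; by rewrite yx.
rewrite add0n; congr #|pred_of_set _|; apply/setP => z; rewrite !inE.
by case: eqP => //= ->; rewrite ltnNge xy /= andbF.
Qed.

Lemma fsignM x S : fsign x S * fsign x S = 1.
Proof. by rewrite -expr2 sqrr_sign. Qed.

Lemma annih_fket x S : annih x *m fket S =
  (if x \in S then fsign x (S :\ x) else 0) *: fket (S :\ x).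
Proof.
apply/colP => i; rewrite /fket -colE !mxE /fconf enum_rankK.
rewrite -(inj_eq enum_val_inj i) enum_rankK.
have [xS|xS] /= := boolP (x \in S); last first.
  rewrite mul0r; case: eqP => [E|]; last by rewrite andbF rmorph0.
  by rewrite E setU11 in xS.
have [->|ne] := eqVneq (enum_val i) (S :\ x).
  by rewrite setD11 setD1K // eqxx mulr1 rmorph_sign.
rewrite mulr0; case: ifP => [/andP[xi /eqP E]|]; last by rewrite rmorph0.
by rewrite E setU1K // eqxx in ne.
Qed.

Lemma fket_creation x (S : {set 'I_N}) : x \in S ->
  fket S = fsign x (S :\ x) *: (creation x *m fket (S :\ x)).
Proof.
by move=> xS; rewrite creation_fket setD11 /= setD1K // scalerA fsignM scale1r.
Qed.

Lemma sign_anti (x y : 'I_N) : x != y ->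
  (-1) ^+ (x < y)%N = - (-1) ^+ (y < x)%N :> C.
Proof.
by rewrite -val_eqE /=; case: ltngtP; rewrite ?expr0 ?expr1 ?opprK.
Qed.

Lemma creationCAR x y : creation x *m creation y + creation y *m creation x = 0.
Proof.
apply: fketP => S; rewrite mul0mx mulmxDl -!mulmxA !creation_fket -!scalemxAr.
rewrite !creation_fket !scalerA !inE (eq_sym y x).
have [->|xy] := eqVneq x y; first by rewrite mulr0 scale0r addr0.
have [xS|xS] := boolP (x \in S); have [yS|yS] := boolP (y \in S) => //=;
  rewrite ?mulr0 ?mul0r ?scale0r ?addr0 //.
rewrite setUCA -scalerDl !fsignU1 // (sign_anti xy).
by rewrite mulNr mulrN mulrCA (mulrCA _ _ (fsign y S)) (mulrC (fsign y S)) subrr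
  scale0r.
Qed.

Lemma annih_creationCAR x y :
  annih x *m creation y + creation y *m annih x = (x == y)%:R%:M.
Proof.
apply: fketP => S; rewrite mul_scalar_mx mulmxDl -!mulmxA.
rewrite creation_fket annih_fket -!scalemxAr creation_fket annih_fket.
rewrite !scalerA !inE (eq_sym y x).
have [->|xy] := eqVneq x y => /=.
  have [yS|yS] := boolP (y \in S); rewrite ?mul0r ?scale0r ?add0r ?addr0 /=.
    by rewrite setD1K // fsignM.
  by rewrite setU1K // fsignM.
rewrite scale0r.
have [yS|yS] := boolP (y \in S) => /=; first by rewrite mul0r mulr0 !scale0r addr0.
have [xS|xS] := boolP (x \in S) => /=; last by rewrite !(mul0r, mulr0) !scale0r addr0.
have E : (y |: S) :\ x = y |: (S :\ x).
  by apply/setP => z; rewrite !inE; have [->|] := eqVneq z x; rewrite ?(negPf xy).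
have -> : fsign y S = (-1) ^+ (x < y)%N * fsign y (S :\ x).
  by rewrite -fsignU1 ?setD1K // !inE eqxx.
rewrite E -scalerDl fsignU1 ?inE ?(negPf yS) ?andbF // (sign_anti xy).
set s := (-1) ^+ _; set a := fsign y _; set b := fsign x _.
have -> : - s * a * (s * b) = - ((s * s) * (a * b)).
  by rewrite mulNr mulNr mulrACA.
by rewrite -expr2 sqrr_sign mul1r (mulrC b) addNr scale0r.
Qed.

Lemma annih_vac x : annih x *m vac = 0.
Proof. by rewrite /vac annih_fket in_set0 scale0r. Qed.

Lemma fock_ind (p : nat) (A B : 'M[C]_(p, #|{set 'I_N}|)) :
  A *m vac = B *m vac ->
  (forall x S, A *m fket S = B *m fket S ->
    A *m (creation x *m fket S) = B *m (creation x *m fket S)) ->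
  A = B.
Proof.
move=> AB0 ABS; apply: fketP => S.
have [k] := ubnP #|S|; elim: k S => // k IH S Sk.
have [->|[x xS]] := set_0Vmem S; first exact: AB0.
rewrite (fket_creation xS) -!scalemxAr ABS // IH //.
by move: Sk; rewrite (cardsD1 x S) xS.
Qed.

Lemma fock_op_eq (B : 'I_N -> fock_op) (U U' : fock_op) :
  U *m vac = U' *m vac ->
  (forall x, U *m creation x = B x *m U) ->
  (forall x, U' *m creation x = B x *m U') -> U = U'.
Proof.
move=> U0 UB UB'; apply: fock_ind => // x S E.
by rewrite !mulmxA UB UB' -!mulmxA E.
Qed.

Section SecondQuantizedExistence.
Variable V : 'M[C]_N.
Hypothesis V_unitary : V \is unitarymx.

Let b (x : 'I_N) : fock_op := \sum_y V y x *: creation y.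

Let bt x : (b x)^t* = \sum_y (V y x)^* *: annih y.
Proof.
rewrite /b raddf_sum /= raddf_sum; apply: eq_bigr => y _.
by rewrite linearZ /= map_mxZ.
Qed.

Let bCAR x y : b x *m b y + b y *m b x = 0.
Proof.
rewrite /b !mulmx_suml.
under eq_bigr do rewrite mulmx_sumr.
under [X in _ + X]eq_bigr do rewrite mulmx_sumr.
rewrite [X in _ + X]exchange_big -big_split big1 // => i _ /=.
rewrite -big_split big1 // => j _ /=.
rewrite -!scalemxAl -!scalemxAr !scalerA (mulrC (V j y)) -scalerDr.
by rewrite creationCAR scaler0.
Qed.

Let bbtCAR x y : (b x)^t* *m b y + b y *m (b x)^t* = (x == y)%:R%:M.
Proof.
rewrite bt /b !mulmx_suml.
under eq_bigr do rewrite mulmx_sumr.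
under [X in _ + X]eq_bigr do rewrite mulmx_sumr.
rewrite [X in _ + X]exchange_big -big_split /=.
transitivity (\sum_i \sum_j ((V i x)^* * V j y * (i == j)%:R)%:M : fock_op).
  apply: eq_bigr => i _; rewrite -big_split /=; apply: eq_bigr => j _.
  rewrite -!scalemxAl -!scalemxAr !scalerA (mulrC (V j y)) -scalerDr.
  by rewrite annih_creationCAR scale_scalar_mx.
have -> : (x == y)%:R = (V^t* *m V) x y.
  have /unitarymxP/mulmx1C -> := V_unitary.
  by rewrite !mxE.
rewrite mxE raddf_sum; apply: eq_bigr => i _ /=.
rewrite (bigD1 i) //= eqxx mulr1 big1 ?addr0 => [|j ji]; first by rewrite !mxE.
by rewrite eq_sym (negPf ji) mulr0 raddf0.
Qed.

Let bb0 x : b x *m b x = 0.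
Proof.
have /eqP := bCAR x x.
by rewrite -mulr2n -scaler_nat scaler_eq0 pnatr_eq0 /= => /eqP.
Qed.

Let G : fock_op := \matrix_(i, j) ((\prod_(x in fconf j) b x) *m vac) i 0.

Let Gket (S : {set 'I_N}) : G *m fket S = (\prod_(x in S) b x) *m vac.
Proof. by apply/colP => i; rewrite /fket -colE !mxE /fconf enum_rankK. Qed.

Let Gvac : G *m vac = vac.
Proof. by rewrite /vac Gket big_pred0 ?mul1mx // => x; rewrite in_set0. Qed.

Let b_prodS x (S : {set 'I_N}) : b x *m (\prod_(y in S) b y) =
  (if x \notin S then fsign x S else 0) *: \prod_(y in x |: S) b y.
Proof.
have anti y z : b y * b z = - (b z * b y).
  by apply/eqP; rewrite -addr_eq0; apply/eqP/bCAR.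
rewrite mulmxE (anticommuting_prod anti bb0).
case: ifP => _; last by rewrite scale0r.
by rewrite /fsign -signr_odd mulr_sign -[in RHS]signr_odd scaler_sign.
Qed.

Let G_creation x : G *m creation x = b x *m G.
Proof.
apply: fketP => S; rewrite -!mulmxA creation_fket -scalemxAr !Gket.
by rewrite mulmxA b_prodS -scalemxAl.
Qed.

Let G_annih x : G *m annih x = (b x)^t* *m G.
Proof.
apply: fock_ind => [|y S E].
  rewrite -!mulmxA annih_vac mulmx0 Gvac bt mulmx_suml big1 // => y _.
  by rewrite -scalemxAl annih_vac scaler0.
have cxy : annih x *m creation y = (x == y)%:R%:M - creation y *m annih x.
  by rewrite -(annih_creationCAR x y) addrK.
have bxy : (b x)^t* *m b y = (x == y)%:R%:M - b y *m (b x)^t*.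
  by rewrite -(bbtCAR x y) addrK.
rewrite -!mulmxA in E *.
rewrite (mulmxA (annih x)) (mulmxA G (creation y)) G_creation -(mulmxA (b y)).
rewrite (mulmxA ((b x)^t*)) cxy bxy !mulmxBl mulmxBr !mul_scalar_mx -scalemxAr.
by congr (_ - _); rewrite -!mulmxA (mulmxA G) G_creation -mulmxA E.
Qed.

Let G_adj_vac : G^t* *m vac = vac.
Proof.
have v_annih (B : fock_op) : B^t* *m vac = 0 -> vac^t* *m B = 0.
  move=> B0; rewrite -[LHS]trmxCK adjM trmxCK B0.
  by rewrite trmx0 map_mx0.
suff E : vac^t* *m G = vac^t*.
  by rewrite -[RHS]trmxCK -E adjM trmxCK.
apply: fock_ind => [|x S E]; first by rewrite -mulmxA Gvac.
rewrite !mulmxA (v_annih _ (annih_vac x)) -(mulmxA _ G) G_creation mulmxA.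
rewrite v_annih ?mul0mx // bt mulmx_suml big1 // => y _.
by rewrite -scalemxAl annih_vac scaler0.
Qed.

Let G_unitary : G \is unitarymx.
Proof.
apply/unitarymxP/mulmx1C.
apply: (fock_op_eq (B := creation)) => [|x|x].
- by rewrite -mulmxA Gvac G_adj_vac mul1mx.
- rewrite -mulmxA G_creation !mulmxA; congr (_ *m _); apply/esym.
  by have := congr1 (fun A => A^t*) (G_annih x); rewrite !adjM !trmxCK.
- by rewrite mul1mx mulmx1.
Qed.

Lemma second_quantization_exists : exists U : fock_op,
  [/\ U \is unitarymx, U *m vac = vac &
      forall x, U *m creation x *m U^t* = \sum_y V y x *: creation y].
Proof.
exists G; split=> // x.
by rewrite G_creation -mulmxA (unitarymxP G_unitary) mulmx1.
Qed.

Lemma second_quantization_unique (U U' : fock_op) :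
    U \is unitarymx -> U *m vac = vac ->
    (forall x, U *m creation x *m U^t* = \sum_y V y x *: creation y) ->
    U' \is unitarymx -> U' *m vac = vac ->
    (forall x, U' *m creation x *m U'^t* = \sum_y V y x *: creation y) ->
  U = U'.
Proof.
move=> Uu U0 UV Uu' U0' UV'; apply: (fock_op_eq (B := b)) => [|x|x].
- by rewrite U0 U0'.
- by rewrite -[LHS]mulmx1 -(mulmx1C (unitarymxP Uu)) mulmxA UV.
- by rewrite -[LHS]mulmx1 -(mulmx1C (unitarymxP Uu')) mulmxA UV'.
Qed.
End SecondQuantizedExistence.
End Fock.

Arguments fock_op : clear implicits.
Arguments fock_vec : clear implicits.

Section BlockModes.
Context {C : numClosedFieldType} {m d : nat}.

(* The mode with block j and internal label alpha is numbered
   mxvec_index j alpha = j * d + alpha. *)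
Definition bcreation (j : 'I_m) (a : 'I_d) : fock_op C (m * d) :=
  creation (mxvec_index j a).

Definition mxblk (V : 'M[C]_(m * d)) (j k : 'I_m) : 'M[C]_d :=
  \matrix_(nu, a) V (mxvec_index j nu) (mxvec_index k a).

Definition is_second_quantization (V : 'M[C]_(m * d)) (U : fock_op C (m * d)) :=
  [/\ U \is unitarymx, U *m vac = vac &
      forall (k : 'I_m) (a : 'I_d), U *m bcreation k a *m U^t* =
        \sum_(j < m) \sum_(nu < d) mxblk V j k nu a *: bcreation j nu].

Let sum_modes (V : 'M[C]_(m * d)) k a :
  \sum_(j < m) \sum_(nu < d) mxblk V j k nu a *: bcreation j nu =
  \sum_y V y (mxvec_index k a) *: creation y.
Proof.
rewrite pair_big (reindex _ (curry_mxvec_bij m d)) /=.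
by apply: eq_bigr => -[j nu] _ /=; rewrite mxE.
Qed.

Lemma is_second_quantization_exists (V : 'M[C]_(m * d)) :
  V \is unitarymx -> exists U, is_second_quantization V U.
Proof.
move=> /second_quantization_exists[U [Uu U0 UV]].
by exists U; split=> // k a; rewrite sum_modes UV.
Qed.

Lemma is_second_quantization_unique (V : 'M[C]_(m * d)) U U' :
  is_second_quantization V U -> is_second_quantization V U' -> U = U'.
Proof.
move=> [Uu U0 UV] [Uu' U0' UV'].
apply: (second_quantization_unique (V := V)) => // x.
  by case/mxvec_indexP: x => k a; rewrite -sum_modes -UV.
by case/mxvec_indexP: x => k a; rewrite -sum_modes -UV'.
Qed.

(* c_j = 1 in the monitoring record of the occupation configuration S *)
Definition singly_occupied (S : {set 'I_(m * d)}) (j : 'I_m) : bool :=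
  #|[set a : 'I_d | mxvec_index j a \in S]| == 1%N.

Definition collision_free (n : nat) (S : {set 'I_(m * d)}) : bool :=
  (#|S| == n) && (#|[set j | singly_occupied S j]| == n).

Definition collision_free_proj (n : nat) : fock_op C (m * d) :=
  \matrix_(i, j) ((i == j) && collision_free n (fconf i))%:R.

(* [aux_ket a] is |a_1, ..., a_n> in (C^d)^{(x) n}. *)
Definition aux_ket (n : nat) (a : {ffun 'I_n -> 'I_d}) :
  'cV[C]_#|{ffun 'I_n -> 'I_d}| := delta_mx (enum_rank a) 0.

(* Blocks and the n input positions are numbered from 0, so that the k-th input
   fermion is in block m - n + k. *)
Definition input_block (n : nat) (hnm : (n <= m)%N) (k : 'I_n) : 'I_m :=
  cast_ord (subnK hnm) (rshift (m - n) k).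

Definition psi_in (n : nat) (hnm : (n <= m)%N) :
    'M[C]_(#|{set 'I_(m * d)}| * #|{ffun 'I_n -> 'I_d}|, 1 * 1) :=
  sqrtC d%:R ^- n *: \sum_(a : {ffun 'I_n -> 'I_d})
    ((\prod_(k < n) bcreation (input_block hnm k) (a k)) *m vac) *t aux_ket a.

End BlockModes.

From mathcomp Require Import all_classical all_reals all_analysis.
Import numFieldNormedType.Exports.
Local Open Scope classical_set_scope.
Local Open Scope complex_scope.

Section HaarUnitary.
Context (R : realType) (N : nat).

(* [R[i]^o] is [R[i]] with its norm topology. *)
Definition unitary_set : set 'M[R[i]^o]_N :=
  [set V | (V : 'M[R[i]]_N) \is unitarymx].

Definition unitary_group : Type := set_type unitary_set.

HB.instance Definition _ := Topological.on unitary_group.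

Definition umx (V : unitary_group) : 'M[R[i]]_N := set_val V.

Lemma umx_unitary (V : unitary_group) : umx V \is unitarymx.
Proof. exact: (set_mem (valP V)). Qed.

Let unitarymx1 : (1%:M : 'M[R[i]]_N) \is unitarymx.
Proof. by apply/unitarymxP; rewrite trmx1 map_mx1 mulmx1. Qed.

Definition unitary1 : unitary_group :=
  SigSub (mem_set (unitarymx1 : unitary_set 1%:M)).

HB.instance Definition _ := isPointed.Build unitary_group unitary1.

Definition unitary_mul (W V : unitary_group) : unitary_group :=
  SigSub (mem_set (mul_unitarymx (umx_unitary W) (umx_unitary V)
    : unitary_set (umx W *m umx V))).

Definition borel_unitary := g_sigma_algebraType (@open unitary_group).

(* On a compact group the left-invariant Borel probability exists and is
   unique, and it is also right-invariant: this is the Haar measure. *)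
Definition is_haar (mu : probability borel_unitary R) :=
  forall (W : unitary_group) (A : set borel_unitary),
    measurable A -> mu (unitary_mul W @^-1` A) = mu A.

End HaarUnitary.

Section EffectiveProbability.
Context {R : realType}.

Definition normsq p (psi : 'cV[R[i]]_p) : R := \sum_i Normc.normc (psi i 0) ^+ 2.

(* The operator U(V); it exists and is unique by [second_quantizedP] and
   [is_second_quantization_unique]. *)
Definition second_quantized (m d : nat) (V : 'M[R[i]]_(m * d)) :
    fock_op R[i] (m * d) :=
  xget 0 [set U | is_second_quantization V U].

Lemma second_quantizedP (m d : nat) (V : 'M[R[i]]_(m * d)) :
  V \is unitarymx -> is_second_quantization V (second_quantized V).
Proof. by move=> /is_second_quantization_exists; exact: xgetPex. Qed.

(* E_V || Pi U(V) |Psi_in> ||^2, where Pi and U(V) act on the fermionic factor,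
   the average being over V distributed according to [mu]. *)
Definition p_e (n m d : nat) (hnm : (n <= m)%N)
    (mu : probability (borel_unitary R (m * d)) R) : \bar R :=
  'E_mu[fun V =>
    normsq ((collision_free_proj n *t 1%:M) *m
            ((second_quantized (umx V) *t 1%:M) *m psi_in hnm))].

End EffectiveProbability.

(* Main.v *)
(* Up to a sign, a permutation matrix acts on the Fock states by relabeling the
   modes.  By left invariance of the Haar measure under permutation matrices,
   all configurations of n fermions are therefore equally likely outputs, each
   with probability 1/C(md, n) since the fermion number is conserved.  As
   C(m, n) d^n configurations are collision-free,
     p_e = C(m, n) d^n / C(md, n) >= \prod_(i < n) (1 - i/m),
   which is the birthday probability, bounded below when m = kappa n^2. *)
Require Import Defs.
From HB Require Import structures.
From mathcomp Require Import all_boot all_order all_algebra all_fingroup.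
From mathcomp Require Import spectral complex mxtens.
From mathcomp Require Import all_classical all_reals all_analysis.
From mathcomp Require Import measurable_realfun.
From mathcomp Require Import lra.

Set Implicit Arguments.
Unset Strict Implicit.
Unset Printing Implicit Defensive.

Import Order.TTheory GRing.Theory Num.Theory.
Import numFieldNormedType.Exports.
Local Open Scope ring_scope.

(** * Counting collision-free configurations *)

(** List [A] before its complement and [B] before its complement. The cardinals agree, so matching
    equal positions gives a permutation that carries [A] to [B]. *)
Lemma exists_perm_imset (T : finType) (A B : {set T}) :
  #|A| = #|B| -> exists s : {perm T}, s @: A = B.
Proof.
move=> AB; pose sA := enum A ++ enum (~: A); pose sB := enum B ++ enum (~: B).
have sAP x : x \in sA by rewrite mem_cat !mem_enum inE orbN.
have sABs : size sA = size sB.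
  rewrite !size_cat -!cardE [#|~: A|]cardsCs [#|~: B|]cardsCs.
  by rewrite !finset.setCK AB.
have sBu : uniq sB.
  rewrite cat_uniq !enum_uniq andbT /=; apply/hasPn => x.
  by rewrite !mem_enum inE.
pose f x := nth x sB (index x sA).
have f_inj : injective f.
  move=> x y; rewrite /f (@set_nth_default _ sB y x) -?sABs ?index_mem //.
  move/eqP; rewrite nth_uniq -?sABs ?index_mem // => /eqP E.
  by rewrite -(nth_index x (sAP x)) E nth_index.
exists (perm f_inj); apply/eqP.
rewrite eqEcard card_imset ?AB ?leqnn ?andbT; last exact: perm_inj.
apply/fintype.subsetP => _ /imsetP[x xA ->]; rewrite permE /f.
have xi : (index x (enum A) < #|A|)%N by rewrite cardE index_mem mem_enum.
rewrite /sA index_cat mem_enum xA nth_cat -cardE -AB xi -mem_enum mem_nth //.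
by rewrite -cardE -AB.
Qed.

Lemma mxvec_index_inj m d (j j' : 'I_m) (a a' : 'I_d) :
  mxvec_index j a = mxvec_index j' a' -> j = j' /\ a = a'.
Proof.
have [g gK _] := curry_mxvec_bij m d.
by move=> E; have := gK (j, a) isT; rewrite /= E (gK (j', a') isT) => -[].
Qed.

Section CollisionFreeCount.
Variables (m d n : nat) (a0 : 'I_d).

(** Labels outside the chosen blocks are pinned to [a0], so that a configuration determines its pair
    and each set of n blocks carries exactly d^n label functions. *)
Let labelled_blocks :=
  [set p : {set 'I_m} * {ffun 'I_m -> 'I_d} |
    (#|p.1| == n) && (p.2 \in pffun_on a0 p.1 predT)].

Let modes (p : {set 'I_m} * {ffun 'I_m -> 'I_d}) : {set 'I_(m * d)} :=
  [set mxvec_index j (p.2 j) | j in p.1].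

Let modesP p j a : (mxvec_index j a \in modes p) = (j \in p.1) && (a == p.2 j).
Proof.
apply/imsetP/andP => [[j' j'p /mxvec_index_inj[-> ->]]|[jp /eqP ->]] //.
by exists j.
Qed.

Let card_labelled_blocks : #|labelled_blocks| = ('C(m, n) * d ^ n)%N.
Proof.
rewrite -sum1_card.
rewrite (eq_bigl (fun p : {set 'I_m} * {ffun 'I_m -> 'I_d} =>
  (#|p.1| == n) && (p.2 \in pffun_on a0 p.1 predT))) => [|p]; last first.
  by rewrite inE.
rewrite -(pair_big_dep (fun A : {set 'I_m} => #|A| == n)
  (fun A f => f \in pffun_on a0 A predT) (fun _ _ => 1%N)) /=.
rewrite (eq_bigr (fun=> d ^ n)%N) => [|A /eqP An]; last first.
  by rewrite sum1_card card_pffun_on An card_ord.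
rewrite sum_nat_const; congr (_ * _)%N.
by have := card_draws 'I_m n; rewrite card_ord cardsE.
Qed.

Let modes_inj : {in labelled_blocks &, injective modes}.
Proof.
move=> [A f] [B g]; rewrite !inE /= => /andP[_ /pffun_onP[Af _]].
move=> /andP[_ /pffun_onP[Bg _]] E.
have EP j a : (j \in A) && (a == f j) = (j \in B) && (a == g j).
  by have := modesP (A, f) j a; rewrite E modesP /= => <-.
have AB : A = B.
  apply/setP => j; have := EP j (f j); have := EP j (g j); rewrite !eqxx !andbT.
  by case: (j \in A); case: (j \in B) => //= ->.
congr (_, _) => //; apply/ffunP => j.
have [jA|jA] := boolP (j \in A).
  by have := EP j (f j); rewrite -AB jA eqxx /= => /esym/eqP.
by rewrite (supportP Af) // (supportP Bg) // -AB.
Qed.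

Lemma leq_collision_free :
  ('C(m, n) * d ^ n <=
     #|[set S : {set 'I_(m * d)} | @collision_free m d n S]|)%N.
Proof.
rewrite -card_labelled_blocks -(card_in_imset modes_inj).
apply/subset_leq_card/fintype.subsetP => _ /imsetP[[A f] + ->].
rewrite !inE /= => /andP[/eqP An _].
rewrite /collision_free card_in_imset ?An ?eqxx /=; last first.
  by move=> j j' _ _ /mxvec_index_inj[].
rewrite (_ : [set j | singly_occupied (modes (A, f)) j] = A) ?An //.
apply/setP => j; rewrite inE /singly_occupied.
have [jA|jA] := boolP (j \in A).
  rewrite (_ : [set a | _] = [set f j]) ?cards1 //.
  by apply/setP => a; rewrite !inE modesP /= jA.
rewrite (_ : [set a | _] = finset.set0) ?cards0 //.
by apply/setP => a; rewrite !inE modesP /= (negPf jA).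
Qed.

End CollisionFreeCount.

(** * The birthday bound *)

Lemma ffact_le_expn m n : (m ^_ n <= m ^ n)%N.
Proof.
rewrite ffact_prod; rewrite -[X in (_ <= _ ^ X)%N]card_ord -prod_nat_const.
by apply: leq_prod => i _; exact: leq_subr.
Qed.

(** Cross-multiplied form of C(m, n) d^n / C(md, n) >= m^_n / m^n: after multiplication by n!, both
    sides share the factor m^_n and (md)^_n <= (md)^n remains. *)
Lemma bin_ratio_ge m d n :
  (m ^_ n * 'C(m * d, n) <= ('C(m, n) * d ^ n) * m ^ n)%N.
Proof.
rewrite -(leq_pmul2r (fact_gt0 n)) -mulnA bin_ffact.
have -> : ('C(m, n) * d ^ n * m ^ n * n`! = m ^_ n * (m * d) ^ n)%N.
  rewrite -bin_ffact expnMn -!mulnA; congr (_ * _)%N.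
  by rewrite [RHS]mulnC [(m ^ n * d ^ n)%N]mulnC mulnA.
by rewrite leq_mul2l ffact_le_expn orbT.
Qed.

(** The exponent is spread evenly over the n factors 1 - i/m. Its two summands serve the regimes 2n
    <= m and m < 2n. *)
Lemma birthday_bound (R : realType) (kappa : R) (n m : nat) :
  0 < kappa -> (1 <= n)%N -> (n <= m)%N -> m%:R = kappa * n%:R ^+ 2 ->
  expR (- (2 / kappa + 4 / kappa ^+ 2)) <= (m ^_ n)%:R / m%:R ^+ n.
Proof.
move=> k0 n1 nm mE; set c := 2 / kappa + 4 / kappa ^+ 2.
have n0 : 0 < n%:R :> R by rewrite ltr0n.
have m0 : 0 < m%:R :> R by rewrite ltr0n (leq_trans n1 nm).
have -> : expR (- c) = \prod_(i < n) expR (- (c / n%:R)).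
  rewrite prodr_const card_ord -expRM_natl mulrN mulrCA divff ?mulr1 //.
  exact: lt0r_neq0.
rewrite ffact_prod natr_prod -[X in _ ^+ X]card_ord -prodr_const -prodf_div.
apply: ler_prod => i _; rewrite expR_ge0 /=.
have im : (i < m)%N by rewrite (leq_trans (ltn_ord i)).
have mi0 : 0 < (m - i)%:R :> R by rewrite ltr0n subn_gt0.
have miE : (m - i)%:R = m%:R - i%:R :> R by rewrite natrB // ltnW.
(* m / (m - i) = 1 + i / (m - i) <= exp (i / (m - i)), and i / (m - i) is at
   most 2n/m = 2/(kappa n) if 2n <= m, and at most n <= 4/(kappa^2 n) if not. *)
rewrite expRN -[leRHS]invrK lef_pV2 ?posrE ?expR_gt0 ?invr_gt0 ?divr_gt0 //.
rewrite invf_div.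
have -> : m%:R / (m - i)%:R = 1 + i%:R / (m - i)%:R :> R.
  by rewrite -[X in X + _](divff (lt0r_neq0 mi0)) -mulrDl miE subrK.
apply: le_trans (expR_ge1Dx _) _; rewrite ler_expR ler_pdivrMr // mulrAC.
rewrite ler_pdivlMr //.
have in_ : i%:R <= n%:R :> R by rewrite ler_nat ltnW.
have i0 : 0 <= i%:R :> R by [].
have mi1 : 1 <= m%:R - i%:R :> R by rewrite -miE ler1n subn_gt0.
rewrite miE.
have [nm2|nm2] := leP (2 * n%:R) (m%:R : R).
  apply: (@le_trans _ _ (2 / kappa * (m%:R - i%:R))); last first.
    rewrite ler_wpM2r ?subr_ge0 ?ler_nat 1?ltnW // lerDl.
    by rewrite divr_ge0 // sqr_ge0.
  (* Multiplying by n makes kappa n^2 = m appear; then m <= 2 (m - i) suffices. *)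
  rewrite mulrAC ler_pdivlMr // -(ler_pM2l n0).
  have : i%:R * n%:R ^+ 2 * kappa <= n%:R * m%:R.
    by rewrite -mulrA (mulrC _ kappa) -mE ler_wpM2r // ltW.
  nra.
(* Now m - i is bounded below only by 1, but kappa n < 2 gives i n <= n^2 <= 4 / kappa^2. *)
have kn : kappa * n%:R < 2 by nra.
apply: (@le_trans _ _ (4 / kappa ^+ 2)); last first.
  rewrite -[leLHS]mulr1 ler_pM //; first by rewrite divr_ge0 // sqr_ge0.
  by rewrite lerDr divr_ge0 // ltW.
rewrite ler_pdivlMr ?exprn_gt0 //.
have : (kappa * n%:R) ^+ 2 <= 4.
  have : 0 < kappa * n%:R by rewrite mulr_gt0.
  nra.
apply: le_trans; rewrite exprMn mulrC ler_wpM2l ?sqr_ge0 // expr2.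
by rewrite ler_wpM2r // ltW.
Qed.

(** * Slater states *)

Section SlaterStates.
Local Open Scope sesquilinear_scope.
Variables (C : numClosedFieldType) (N : nat).
Implicit Types (V W : 'M[C]_N) (U : fock_op C N) (r : seq 'I_N).

Definition rotated_creation V x : fock_op C N := \sum_y V y x *: creation y.

(* The state U(V) (prod_(x <- r) a^dagger_x) |vac>. *)
Definition slater V r : fock_vec C N :=
  (\prod_(x <- r) rotated_creation V x) *m vac.

Lemma slater_nil V : slater V [::] = vac.
Proof. by rewrite /slater big_nil mul1mx. Qed.

Lemma slater_cons V x r :
  slater V (x :: r) = \sum_y V y x *: (creation y *m slater V r).
Proof.
rewrite /slater big_cons -mulmxE -mulmxA mulmx_suml.
by apply: eq_bigr => y _; rewrite scalemxAl.
Qed.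

Lemma slater1 r : slater 1%:M r = (\prod_(x <- r) creation x) *m vac.
Proof.
rewrite /slater; congr (_ *m _); apply: eq_bigr => x _.
rewrite /rotated_creation (bigD1 x) //= mxE eqxx scale1r big1 ?addr0 // => y yx.
by rewrite mxE (negPf yx) scale0r.
Qed.

(** [U] moves past each factor, turning the coefficients [V] into [W *m V], until it meets the
    vacuum, which it fixes. *)
Lemma second_quantized_slater W U V r :
  U *m vac = vac ->
  (forall x, U *m creation x = rotated_creation W x *m U) ->
  U *m slater V r = slater (W *m V) r.
Proof.
move=> U0 UW; elim: r => [|x r IH]; first by rewrite !slater_nil.
rewrite !slater_cons mulmx_sumr.
under eq_bigr => y _ do
  rewrite -scalemxAr mulmxA UW -mulmxA IH mulmx_suml scaler_sumr.
rewrite exchange_big; apply: eq_bigr => z _ /=.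
rewrite mxE scaler_suml; apply: eq_bigr => y _.
by rewrite -scalemxAl scalerA mulrC.
Qed.

Lemma slater_particle_number V r i :
  #|fconf i| != size r -> slater V r i 0 = 0.
Proof.
elim: r i => [|x r IH] i.
  rewrite slater_nil /vac /fket mxE andbT.
  by have [->|//] := eqVneq i (enum_rank _); rewrite /fconf enum_rankK cards0.
move=> ir; rewrite slater_cons summxE big1 // => y _.
rewrite !mxE big1 ?mulr0 // => j _; rewrite mxE.
have [/andP[yj /eqP ij]|_] := ifP; last by rewrite mul0r.
by rewrite IH ?mulr0 //; move: ir; rewrite ij cardsU1 yj.
Qed.

Lemma slater1_fket r : uniq r ->
  exists e : nat, slater 1%:M r = (-1) ^+ e *: fket [set x in r].
Proof.
elim: r => [_|x r IH /= /andP[xr /IH[e re]]].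
  by exists 0%N; rewrite slater_nil scale1r; congr fket.
exists (e + #|[set y in [set y in r] | (y < x)%N]|)%N.
rewrite slater_cons (bigD1 x) //= mxE eqxx scale1r.
rewrite big1 ?addr0 => [|y yx]; last first.
  by rewrite mxE (negPf yx) scale0r.
rewrite re -scalemxAr creation_fket inE xr scalerA -exprD; congr (_ *: fket _).
by apply/setP => y; rewrite !inE.
Qed.

(** Build the Fock state one creation operator at a time: [U] relabels each of them, and the mode
    ordering before and after costs only signs, collected in [e]. *)
Lemma relabeling_fket U (t : 'I_N -> 'I_N) (S : {set 'I_N}) :
  injective t -> U *m vac = vac ->
  (forall x, U *m creation x = creation (t x) *m U) ->
  exists e : nat, U *m fket S = (-1) ^+ e *: fket (t @: S).
Proof.
move=> t_inj U0 Ut; have [k] := ubnP #|S|; elim: k S => // k IH S Sk.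
have [->|[x xS]] := set_0Vmem S.
  by exists 0%N; rewrite imset0 scale1r U0.
have [|e Se] := IH (S :\ x).
  by move: Sk; rewrite (cardsD1 x S) xS.
have tx : t x \notin t @: (S :\ x) by rewrite mem_imset // !inE eqxx.
exists (#|[set y in S :\ x | (y < x)%N]| +
        (e + #|[set y in t @: (S :\ x) | (y < t x)%N]|))%N.
rewrite (fket_creation xS) -scalemxAr mulmxA Ut -mulmxA Se -scalemxAr.
rewrite creation_fket tx !scalerA /fsign -!exprD addnA -imsetU1.
by rewrite finset.setD1K.
Qed.

(** Row [t @: S] of [U] has a single nonzero entry, a sign in column [S], because taking images
    under [t] is injective on sets. *)
Lemma relabeling_norm U (t : 'I_N -> 'I_N) (v : fock_vec C N) (S : {set 'I_N}) :
  injective t -> U *m vac = vac ->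
  (forall x, U *m creation x = creation (t x) *m U) ->
  `|(U *m v) (enum_rank (t @: S)) 0| = `|v (enum_rank S) 0|.
Proof.
move=> t_inj U0 Ut.
have UE i j : U i j = (U *m fket (fconf j)) i 0.
  by rewrite /fket /fconf enum_valK -colE mxE.
rewrite mxE (bigD1 (enum_rank S)) //= big1 ?addr0 => [|j jS].
  rewrite UE /fconf enum_rankK; have [e ->] := relabeling_fket S t_inj U0 Ut.
  by rewrite normrM /fket !mxE !eqxx mulr1 normrX normrN1 expr1n mul1r.
rewrite UE; have [e ->] := relabeling_fket (fconf j) t_inj U0 Ut.
rewrite /fket !mxE (inj_eq enum_rank_inj) (inj_eq (imset_inj t_inj)) /fconf.
case: eqP => [E|_]; last by rewrite mulr0 mul0r.
by move: jS; rewrite E enum_valK eqxx.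
Qed.

Lemma perm_mx_unitary (s : 'S_N) : (perm_mx s : 'M[C]_N) \is unitarymx.
Proof.
apply/unitarymxP; rewrite tr_perm_mx map_perm_mx -perm_mxM.
by rewrite mulgV perm_mx1.
Qed.

(** The inverse appears because row i of [perm_mx s] has its 1 in column [s i], so column x has it
    in row [s^-1 x]. *)
Lemma rotated_creation_perm (s : 'S_N) x :
  rotated_creation (perm_mx s) x = creation (s^-1%g x).
Proof.
rewrite /rotated_creation (bigD1 (s^-1%g x)) //= !mxE permKV eqxx scale1r.
rewrite big1 ?addr0 // => y yx; rewrite !mxE.
case: eqP => [E|_]; last by rewrite scale0r.
by move: yx; rewrite -E permK eqxx.
Qed.

(** This turns left translation of [V] into a permutation of output configurations, the form in
    which Haar invariance is applied. *)
Lemma slater_perm (s : 'S_N) V r (S : {set 'I_N}) :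
  `|slater (perm_mx s *m V) r (enum_rank (s^-1%g @: S)) 0| =
  `|slater V r (enum_rank S) 0|.
Proof.
have [U [Uu U0 Us]] := second_quantization_exists (perm_mx_unitary s).
have UE x : U *m creation x = rotated_creation (perm_mx s) x *m U.
  by rewrite /rotated_creation -Us -mulmxA (mulmx1C (unitarymxP Uu)) mulmx1.
rewrite -(second_quantized_slater V r U0 UE).
apply: relabeling_norm => // [|x]; first exact: perm_inj.
by rewrite UE rotated_creation_perm.
Qed.

Lemma unitary_norm p (A : 'M[C]_p) (v : 'cV[C]_p) : A \is unitarymx ->
  \sum_i `|(A *m v) i 0| ^+ 2 = \sum_i `|v i 0| ^+ 2.
Proof.
move=> Au.
have normE (w : 'cV[C]_p) : \sum_i `|w i 0| ^+ 2 = (w^t* *m w) 0 0.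
  by rewrite mxE; apply: eq_bigr => i _; rewrite !mxE mulrC normCK.
rewrite !normE trmx_mul map_mxM -mulmxA (mulmxA (A^t*)).
by rewrite (mulmx1C (unitarymxP Au)) mul1mx.
Qed.

(** The state is the image of a Fock state, up to sign, under a unitary operator, so its norm is 1;
    number conservation confines the sum to sets of size [size r]. *)
Lemma slater_norm V r : V \is unitarymx -> uniq r ->
  \sum_(S : {set 'I_N} | #|S| == size r) `|slater V r (enum_rank S) 0| ^+ 2 = 1.
Proof.
move=> Vu ur.
have [U [Uu U0 UV]] := second_quantization_exists Vu.
have UE x : U *m creation x = rotated_creation V x *m U.
  by rewrite /rotated_creation -UV -mulmxA (mulmx1C (unitarymxP Uu)) mulmx1.
transitivity (\sum_i `|slater V r i 0| ^+ 2).
  rewrite [RHS](reindex_onto enum_rank enum_val) => [|i _]; last first.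
    by rewrite enum_valK.
  rewrite [RHS](bigID (fun S : {set 'I_N} => #|S| == size r)) /=.
  rewrite [X in _ + X]big1 ?addr0 => [|S /andP[_ Sr]].
    by apply: eq_bigl => S; rewrite enum_rankK eqxx.
  by rewrite slater_particle_number ?normr0 ?expr0n // /fconf enum_rankK.
rewrite -[V]mulmx1 -(second_quantized_slater _ _ U0 UE) unitary_norm //.
have [e ->] := slater1_fket ur.
rewrite (bigD1 (enum_rank [set x in r])) //= big1 ?addr0 => [|i ir].
  by rewrite /fket !mxE !eqxx mulr1 normrX normrN1 !expr1n.
by rewrite /fket !mxE (negPf ir) mulr0 normr0 expr0n.
Qed.

End SlaterStates.

(** * Continuity and measurability on the unitary group *)

Section EntrywiseContinuity.
Local Open Scope classical_set_scope.
Variables (T : topologicalType) (K : numFieldType).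

(** Stated per entry, so that matrix sums and products reduce to scalar ones. *)
Definition entrywise_continuous p q (A : T -> 'M[K]_(p, q)) :=
  forall i j, continuous (fun t => A t i j : K^o).

Lemma continuous_sum (I : Type) (r : seq I) (f : I -> T -> K) :
  (forall k, continuous (f k : T -> K^o)) ->
  continuous ((fun t => \sum_(k <- r) f k t) : T -> K^o).
Proof.
move=> cf t; elim: r => [|k r IH].
  by under eq_fun do rewrite big_nil; exact: cvg_cst.
by under eq_fun do rewrite big_cons; apply: cvgD; [exact: cf|exact: IH].
Qed.

Lemma entrywise_continuous_cst p q (A : 'M[K]_(p, q)) :
  entrywise_continuous (fun=> A).
Proof. by move=> i j t; exact: cvg_cst. Qed.

Lemma entrywise_continuous_mul p q r (A : T -> 'M[K]_(p, q))
    (B : T -> 'M[K]_(q, r)) :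
  entrywise_continuous A -> entrywise_continuous B ->
  entrywise_continuous (fun t => A t *m B t).
Proof.
move=> cA cB i j t.
rewrite (_ : (fun t => _) = (fun t => \sum_k A t i k * B t k j)); last first.
  by apply/funext => s; rewrite mxE.
apply: continuous_sum => k s.
by apply: cvgM; [exact: cA|exact: cB].
Qed.

Lemma entrywise_continuous_sum p q (I : Type) (r : seq I)
    (A : I -> T -> 'M[K]_(p, q)) :
  (forall k, entrywise_continuous (A k)) ->
  entrywise_continuous (fun t => \sum_(k <- r) A k t).
Proof.
move=> cA i j t.
rewrite (_ : (fun t => _) = (fun t => \sum_(k <- r) A k t i j)); last first.
  by apply/funext => s; rewrite summxE.
by apply: continuous_sum => k; exact: cA.
Qed.

Lemma entrywise_continuous_scale p q (c : T -> K) (A : T -> 'M[K]_(p, q)) :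
  continuous (c : T -> K^o) -> entrywise_continuous A ->
  entrywise_continuous (fun t => c t *: A t).
Proof.
move=> cc cA i j t.
rewrite (_ : (fun t => _) = (fun t => c t * A t i j)); last first.
  by apply/funext => s; rewrite mxE.
by apply: cvgM; [exact: cc|exact: cA].
Qed.

End EntrywiseContinuity.

Section UnitaryGroup.
Local Open Scope classical_set_scope.
Context (R : realType) (N : nat).

(** By the reverse triangle inequality [normc] is 1-Lipschitz. The bound is stated in [R[i]], where
    the norm of [R[i]^o] takes its values. *)
Lemma normc_continuous (T : topologicalType) (f : T -> R[i]) :
  continuous (f : T -> R[i]^o) -> continuous (fun t => Normc.normc (f t)).
Proof.
have dist_normc (a b : R[i]) :
    (`|Normc.normc a - Normc.normc b|%:C <= (Normc.normc (a - b))%:C)%C.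
  have tri (x y : R[i]) : Normc.normc x <= Normc.normc (x - y) + Normc.normc y.
    by rewrite -{1}(subrK y x) le_normcD.
  rewrite lecR ler_norml lerNl opprB !lerBlDr tri.
  by rewrite -(normcN (a - b)) opprB tri.
move=> cf t; apply/cvgrPdist_lt => e e0.
have /cvgrPdist_lt/(_ (e%:C)%C) := cf t.
rewrite ltcR => /(_ e0); apply: filterS => s fts.
rewrite -ltcR; exact: le_lt_trans (dist_normc (f t) (f s)) fts.
Qed.

Lemma umx_continuous : entrywise_continuous (@umx R N).
Proof.
move=> i j V.
apply: (@continuous_comp (unitary_group R N) 'M[R[i]^o]_N R[i]^o set_val
  (fun M => M i j)).
  exact: initial_continuous.
exact: coord_continuous.
Qed.

Lemma continuous_measurable_unitary (f : unitary_group R N -> R) :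
  continuous f -> measurable_fun setT (f : borel_unitary R N -> R).
Proof.
move=> /continuousP cf; apply: (measurability _ (RGenOpens.measurableE R)).
move=> _ [_ [a [b ->] <-]]; rewrite setTI; apply: sub_sigma_algebra.
exact/cf/interval_open.
Qed.

(** The topology is induced from matrices, where a neighborhood imposes conditions on finitely many
    entries, so these can be met simultaneously. *)
Lemma continuous_to_unitary (T : topologicalType) (f : T -> unitary_group R N) :
  entrywise_continuous (fun t => umx (f t)) -> continuous f.
Proof.
move=> cf; apply: continuous_comp_initial => t A [P /= Pnbhs PA].
have cP : \forall s \near t, forall ij : 'I_N * 'I_N,
    P ij.1 ij.2 (umx (f s) ij.1 ij.2).
  by apply: filter_forall => -[i j]; apply: cf; exact: Pnbhs.
by apply: filterS cP => s Ps; apply: PA => i j; exact: (Ps (i, j)).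
Qed.

Lemma unitary_mul_measurable (W : unitary_group R N) :
  measurable_fun setT (unitary_mul W : borel_unitary R N -> borel_unitary R N).
Proof.
apply: (@measurability _ _ (borel_unitary R N) (borel_unitary R N) setT
  (unitary_mul W) (@open (unitary_group R N)) erefl).
move=> _ [A oA <-]; rewrite setTI; apply: sub_sigma_algebra.
suff : continuous (unitary_mul W) by move/continuousP; exact.
apply: continuous_to_unitary; apply: entrywise_continuous_mul.
  exact: entrywise_continuous_cst.
exact: umx_continuous.
Qed.

End UnitaryGroup.

(** * Haar averages *)

Section HaarAverage.
Context (R : realType) (N : nat) (mu : probability (borel_unitary R N) R).
Hypothesis mu_haar : is_haar mu.

(** Invariance on measurable sets says that left translation pushes [mu] forward to itself; the
    claim is then the change of variables formula. *)
Lemma haar_integral (W : unitary_group R N) (f : borel_unitary R N -> \bar R) :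
  measurable_fun setT f -> (forall V, (0 <= f V)%E) ->
  (\int[mu]_V f (unitary_mul W V) = \int[mu]_V f V)%E.
Proof.
move=> mf f0.
pose phi : {mfun borel_unitary R N >-> borel_unitary R N} :=
  HB.pack (unitary_mul W : borel_unitary R N -> borel_unitary R N)
    (isMeasurableFun.Build _ _ _ _ _ (unitary_mul_measurable W)).
have mphi : measurable_fun setT phi by exact: measurable_funP.
have := ge0_integral_pushforward mphi mu measurableT mf (fun V _ => f0 V).
rewrite preimage_setT => <-.
by apply: eq_measure_integral => A mA _; exact: mu_haar.
Qed.

Definition slater_prob r (S : {set 'I_N}) (V : unitary_group R N) : R :=
  Normc.normc (slater (umx V) r (enum_rank S) 0) ^+ 2.

Lemma slater_prob_ge0 r S V : 0 <= slater_prob r S V.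
Proof. exact: sqr_ge0. Qed.

Lemma slater_continuous r :
  entrywise_continuous (fun V : unitary_group R N => slater (umx V) r).
Proof.
elim: r => [|x r IH].
  under [X in entrywise_continuous X]eq_fun do rewrite slater_nil.
  exact: entrywise_continuous_cst.
under [X in entrywise_continuous X]eq_fun do rewrite slater_cons.
apply: entrywise_continuous_sum => y.
apply: entrywise_continuous_scale; first exact: umx_continuous.
apply: entrywise_continuous_mul => //; exact: entrywise_continuous_cst.
Qed.

Lemma slater_prob_measurable r (S : {set 'I_N}) :
  measurable_fun setT (slater_prob r S : borel_unitary R N -> R).
Proof.
apply: measurable_funX; apply: continuous_measurable_unitary.
by apply: normc_continuous; exact: slater_continuous.
Qed.

Lemma sum_slater_prob r (V : unitary_group R N) : uniq r ->
  \sum_(S : {set 'I_N} | #|S| == size r) slater_prob r S V = 1.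
Proof.
move=> ur; apply: complexI; rewrite rmorph_sum rmorph1.
rewrite -[RHS](slater_norm (umx_unitary V) ur); apply: eq_bigr => S _.
by rewrite /slater_prob rmorphXn.
Qed.

(** By invariance all sets of size [size r] have the same average, and these averages sum to 1. *)
Lemma haar_slater_prob r (S : {set 'I_N}) : uniq r -> #|S| = size r ->
  (\int[mu]_V (slater_prob r S V)%:E = ('C(N, size r)%:R^-1)%:E)%E.
Proof.
move=> ur Sr.
have mE T : measurable_fun setT
    (EFin \o slater_prob r T : borel_unitary R N -> \bar R).
  by apply/measurable_EFinP; exact: slater_prob_measurable.
have ge0 T V : (0 <= (slater_prob r T V)%:E)%E.
  by rewrite lee_fin slater_prob_ge0.
pose q T := (\int[mu]_V (slater_prob r T V)%:E)%E.
have qE (T : {set 'I_N}) : #|T| = size r -> q T = q S.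
  rewrite -Sr => TS; have [s sT] := exists_perm_imset TS.
  (* The inverse cancels the one in [slater_perm], which then moves [T] to [s @: T], that is, to
     [S]. *)
  pose W : unitary_group R N :=
    SigSub (mem_set (perm_mx_unitary R[i] (s^-1)%g : unitary_set _)).
  rewrite /q -(haar_integral W (mE S) (ge0 S)).
  apply: eq_integral => V _ /=.
  have := slater_perm (s^-1)%g (umx V) r T; rewrite invgK sT.
  by rewrite /slater_prob => -[->].
have q_sum : (\sum_(T : {set 'I_N} | #|T| == size r) q T = 1)%E.
  rewrite -big_filter -ge0_integral_sum //.
  under eq_integral => V _ do rewrite sumEFin big_filter sum_slater_prob //.
  rewrite integral_cst // mul1e.
  exact: probability_setT.
have q_ge0 T : (0 <= q T)%E by apply: integral_ge0.
rewrite -/(q S); case qS: (q S) => [x| |].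
- move: q_sum; rewrite (eq_bigr (fun=> x%:E)) => [|T /eqP/qE ->//].
  rewrite sumEFin sumr_const => -[].
  rewrite (_ : #|_| = 'C(N, size r)); last first.
    by have := card_draws 'I_N (size r); rewrite card_ord cardsE.
  move/(etrans (mulr_natl x _)) => Nx.
  (* The total being 1 already forces the number of configurations to be nonzero. *)
  have N0 : 'C(N, size r)%:R != 0 :> R.
    by apply: contra_eq_neq Nx => ->; rewrite mul0r eq_sym oner_eq0.
  by have -> : x = 'C(N, size r)%:R^-1 by apply: (mulfI N0); rewrite Nx mulfV.
(* An infinite term would make the total infinite, as the others are nonnegative. *)
- move: q_sum; rewrite (bigD1 S) ?Sr ?eqxx //= qS addye // gt_eqF //.
  by rewrite (@lt_le_trans _ _ 0%E) ?ltNy0 // sume_ge0.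
- by have := q_ge0 S; rewrite qS.
Qed.

End HaarAverage.

(** * The effective probability as a ratio of counts *)

Lemma normsq_tens (R : realType) p q (v : 'cV[R[i]]_(p * q)) :
  normsq v = \sum_i \sum_j Normc.normc (v (mxtens_index (i, j)) 0) ^+ 2.
Proof.
rewrite /normsq pair_big (reindex (@mxtens_index p q)) /=.
  by apply: eq_bigr => -[].
exists (@mxtens_unindex p q) => x _; first exact: mxtens_indexK.
exact: mxtens_unindexK.
Qed.

Section EffectiveProbabilityFormula.
Context (R : realType) (n m d : nat) (hnm : (n <= m)%N).
Implicit Types (a : {ffun 'I_n -> 'I_d}) (V : unitary_group R (m * d)).

Definition input_modes a : seq 'I_(m * d) :=
  [seq mxvec_index (input_block hnm k) (a k) | k <- index_enum 'I_n].

Lemma size_input_modes a : size (input_modes a) = n.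
Proof. by rewrite size_map -[RHS]card_ord cardT enumT. Qed.

Lemma input_modes_uniq a : uniq (input_modes a).
Proof.
rewrite map_inj_uniq ?index_enum_uniq // => k k'.
move=> /mxvec_index_inj[/cast_ord_inj/rshift_inj //].
Qed.

Lemma second_quantized_input V a :
  second_quantized (umx V) *m
    ((\prod_(k < n) bcreation (input_block hnm k) (a k)) *m vac) =
  slater (umx V) (input_modes a).
Proof.
have [Uu U0 UV] := second_quantizedP (umx_unitary V).
rewrite -[umx V in RHS]mulmx1 -(second_quantized_slater _ _ U0); last first.
  move=> x; case/mxvec_indexP: x => k b.
  rewrite -[LHS]mulmx1 -(mulmx1C (unitarymxP Uu)) mulmxA UV; congr (_ *m _).
  rewrite /rotated_creation pair_big (reindex _ (curry_mxvec_bij m d)) /=.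
  by apply: eq_bigr => -[j nu] _ /=; rewrite mxE.
by rewrite slater1 big_map.
Qed.

(** The auxiliary kets are orthonormal, so different label assignments do not interfere: the outcome
    is a uniform mixture, with weight d^-n, of Slater states. *)
Lemma collision_free_norm V :
  normsq ((collision_free_proj n *t 1%:M) *m
    ((second_quantized (umx V) *t 1%:M) *m psi_in hnm)) =
  \sum_(S : {set 'I_(m * d)} | collision_free n S)
    \sum_a d%:R^-1 ^+ n * slater_prob (input_modes a) S V.
Proof.
pose A a := collision_free_proj n *m slater (umx V) (input_modes a).
have -> : (collision_free_proj n *t 1%:M) *m
    ((second_quantized (umx V) *t 1%:M) *m psi_in hnm) =
    sqrtC d%:R ^- n *: \sum_a A a *t aux_ket a.
  rewrite /psi_in -!scalemxAr !mulmx_sumr; congr (_ *: _).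
  by apply: eq_bigr => a _; rewrite !tensmx_mul !mul1mx second_quantized_input.
rewrite normsq_tens.
have entry i a : (sqrtC d%:R ^- n *: \sum_a A a *t aux_ket a :
      'M[R[i]]_(_, 1 * 1)) (mxtens_index (i, enum_rank a)) 0 =
    sqrtC d%:R ^- n * A a i 0.
  rewrite mxE summxE (bigD1 a) //= big1 ?addr0 => [|b ba].
    by rewrite !mxE !mxtens_indexK /= eqxx mulr1 !ord1.
  rewrite !mxE !mxtens_indexK /= (inj_eq enum_rank_inj) eq_sym (negPf ba).
  by rewrite mulr0.
rewrite (reindex enum_rank) /=; last by apply: onW_bij; exact: enum_rank_bij.
have AE a S : A a (enum_rank S) 0 =
    (collision_free n S)%:R * slater (umx V) (input_modes a) (enum_rank S) 0.
  rewrite mxE (bigD1 (enum_rank S)) //= big1 ?addr0 => [|j jS].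
    by rewrite mxE eqxx /fconf enum_rankK.
  by rewrite mxE eq_sym (negPf jS) mul0r.
(* The squared modulus of the normalization is the mixture weight. *)
have cE : Normc.normc (sqrtC (d%:R : R[i]) ^- n) ^+ 2 = d%:R^-1 ^+ n.
  apply: complexI; rewrite rmorphXn.
  rewrite [LHS](_ : _ = `|sqrtC (d%:R : R[i]) ^- n| ^+ 2) // normfV normrX.
  rewrite ger0_norm ?sqrtC_ge0 ?ler0n // !exprVn -exprM mulnC exprM sqrtCK.
  by rewrite fmorphV rmorphXn rmorph_nat.
rewrite [RHS]big_mkcond; apply: eq_bigr => S _.
rewrite (reindex enum_rank) /=; last by apply: onW_bij; exact: enum_rank_bij.
case: ifPn => SF.
  apply: eq_bigr => a _.
  by rewrite entry Normc.normcM exprMn cE AE SF mul1r.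
rewrite big1 // => a _; rewrite entry AE (negPf SF) mul0r mulr0.
by rewrite Normc.normc0 expr0n.
Qed.

(** Each Slater probability averages to 1/C(md, n), whatever the labels, and the d^n assignments
    cancel the weight d^-n. *)
Lemma p_e_eq (mu : probability (borel_unitary R (m * d)) R) :
  (0 < d)%N -> is_haar mu ->
  p_e hnm mu =
  (#|[set S : {set 'I_(m * d)} | collision_free n S]|%:R / 'C(m * d, n)%:R)%:E.
Proof.
move=> d0 mu_haar; rewrite /p_e unlock.
have dn_ge0 : 0 <= d%:R^-1 ^+ n :> R by rewrite exprn_ge0 ?invr_ge0.
under eq_integral => V _ do rewrite collision_free_norm -sumEFin -big_filter.
rewrite ge0_integral_sum //; last 2 first.
- move=> S; apply/measurable_EFinP; apply: measurable_sum => a.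
  apply: measurable_funM => //; exact: slater_prob_measurable.
- move=> S V _; rewrite lee_fin sumr_ge0 // => a _.
  exact: mulr_ge0 dn_ge0 (slater_prob_ge0 _ _ _).
rewrite big_filter (eq_bigr (fun=> ('C(m * d, n)%:R^-1)%:E)) => [|S SF].
  by rewrite sumEFin sumr_const cardsE mulr_natl.
under eq_integral => V _ do rewrite -sumEFin.
rewrite ge0_integral_sum //; last 2 first.
- move=> a; apply/measurable_EFinP.
  apply: measurable_funM => //; exact: slater_prob_measurable.
- move=> a V _; rewrite lee_fin.
  exact: mulr_ge0 dn_ge0 (slater_prob_ge0 _ _ _).
rewrite (eq_bigr (fun=> (d%:R^-1 ^+ n * 'C(m * d, n)%:R^-1)%:E)) => [|a _].
  rewrite sumEFin sumr_const card_ffun !card_ord -mulrnAl -mulr_natr natrX.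
  by rewrite -exprMn mulVf ?pnatr_eq0 -?lt0n // expr1n mul1r.
under eq_integral => V _ do rewrite EFinM.
rewrite ge0_integralZl_EFin //; last 2 first.
- by move=> V _; rewrite lee_fin slater_prob_ge0.
- by apply/measurable_EFinP; exact: slater_prob_measurable.
rewrite haar_slater_prob ?size_input_modes ?input_modes_uniq //.
by case/andP: SF => /eqP.
Qed.

End EffectiveProbabilityFormula.

Theorem lemma1 (R : realType) (d : nat) (kappa : R)
    (hd : (2 <= d)%N) (hkappa : 0 < kappa) :
  exists c : R, 0 < c /\
    forall (n m : nat) (hn : (1 <= n)%N) (hnm : (n <= m)%N)
      (hm : m%:R = kappa * n%:R ^+ 2)
      (mu : probability (borel_unitary R (m * d)) R) (hmu : is_haar mu),
      (c%:E <= p_e hnm mu)%E.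
Proof.
exists (expR (- (2 / kappa + 4 / kappa ^+ 2))); split; first exact: expR_gt0.
move=> n m hn hnm hm mu hmu.
have d0 : (0 < d)%N by rewrite ltnW.
rewrite p_e_eq // lee_fin; apply: le_trans (birthday_bound hkappa hn hnm hm) _.
have m0 : (0 < m)%N by rewrite (leq_trans hn).
have bin0 : (0 < 'C(m * d, n))%N.
  by rewrite bin_gt0 (leq_trans hnm) // leq_pmulr.
(* Clearing denominators leaves an inequality between natural numbers. *)
rewrite ler_pdivrMr ?exprn_gt0 ?ltr0n // mulrAC ler_pdivlMr ?ltr0n //.
rewrite -natrX -!natrM ler_nat (leq_trans (bin_ratio_ge _ _ _)) //.
(* Since d > 0, the label 0 can serve as the default [a0] of the count. *)
by rewrite leq_mul2r leq_collision_free ?orbT //; exact: Ordinal d0.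
Qed.
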